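(* Let $P$ be a bipartite graph. The following are equivalent: (1) the flag ideal $\mathcal{F}(P)$ has a linear resolution; (2) $P$ does not have an induced subgraph consisting of two disjoint edges, i.e. an induced subgraph on four vertices $p_1,p_2$ (in one part) and $q_1,q_2$ (in the other part) whose edges are exactly $\{p_1,q_1\}$ and $\{p_2,q_2\}$; (3) $P$ is a Ferrers graph.
   Context: Let $\Bbbk$ be a field; all posets and graphs are finite. A bipartite graph $G$ is a simple graph whose vertex set can be written as a union $A\cup B$ such that any edge of $G$ contains an element of $A$ and an element of $B$. It is identified with the poset with cover relations $a\le b$ where $a\in A$, $b\in B$ and $\{a,b\}$ is an edge of $G$. The flag ideal $\mathcal{F}(P)$ of a finite poset $P$ is the squarefree monomial ideal of $\Bbbk[x_p : p\in P]$ generated by all monomials $x_{p_1}\cdots x_{p_n}$ with $p_1<\cdots<p_n$ a maximal chain of $P$; for a bipartite graph it is identified with the edge ideal, generated by all $x_ax_b$ with $\{a,b\}$ an edge. A Ferrers graph is a bipartite graph $G$ on two distinct vertex sets $\{x_1,\ldots,x_n\}$ and $\{y_1,\ldots,y_m\}$ satisfying: (i) if $\{x_p,y_q\}$ is an edge of $G$, then for all $i\le p$ and $j\le q$, $\{x_i,y_j\}$ is an edge of $G$ as well; and (ii) $\{x_1,y_m\}$ and $\{x_n,y_1\}$ are edges of $G$.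
   Formalization: The bipartite graph P is assumed to have at least one vertex and no isolated vertices; otherwise the claim fails: one edge plus an isolated vertex, or the empty graph, satisfies (2) but is not a Ferrers graph. *)

(* Defs.v *)
From HB Require Import structures.
From mathcomp Require Import all_boot all_order all_algebra.
From mathcomp Require Import mpoly.

Set Implicit Arguments.
Unset Strict Implicit.
Unset Printing Implicit Defensive.

Import Order.TTheory GRing.Theory.

Local Open Scope ring_scope.

Record bigraph := BiGraph {
  vertex :> finType;
  edge : rel vertex;
  partA : {set vertex};
  partB : {set vertex};
  edge_sym : ssrbool.symmetric edge;
  edge_irr : irreflexive edge;
  part_cover : partA :|: partB = [set: vertex];
  part_disjoint : [disjoint partA & partB];
  edge_parts : forall u v, edge u v ->
    (u \in partA) && (v \in partB) || (u \in partB) && (v \in partA)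
}.

Definition no_isolated (G : bigraph) : Prop := forall u : G, exists v, edge u v.

(* An alias of the vertex type, carrying the order whose cover relations are
   a < b for a in partA, b in partB and {a, b} an edge. *)
Definition poset_of (G : bigraph) : Type := vertex G.

HB.instance Definition _ (G : bigraph) := Finite.on (poset_of G).

Fact bg_display : Order.disp_t. Proof. exact: Order.Disp tt tt. Qed.

Section PosetOfBigraph.
Variable G : bigraph.

Definition bg_le : rel (poset_of G) := fun u v =>
  (u == v) || [&& u \in partA G, v \in partB G & edge (u : G) v].

Lemma bg_AB (u : G) : u \in partA G -> u \in partB G -> False.
Proof. by move=> uA; rewrite (disjointFr (part_disjoint G) uA). Qed.

Lemma bg_le_refl : reflexive bg_le.
Proof. by move=> u; rewrite /bg_le eqxx. Qed.

Lemma bg_le_anti : antisymmetric bg_le.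
Proof.
move=> u v /andP[/orP[/eqP //|/and3P[uA _ _]] /orP[/eqP //|/and3P[_ uB _]]].
by case: (bg_AB uA uB).
Qed.

Lemma bg_le_trans : transitive bg_le.
Proof.
move=> v u w /orP[/eqP -> //|/and3P[uA vB uv]] /orP[/eqP <-|/and3P[vA _ _]].
  by rewrite /bg_le uA vB uv orbT.
by case: (bg_AB vA vB).
Qed.

HB.instance Definition _ := Order.Le_isPOrder.Build bg_display
  (poset_of G) bg_le_refl bg_le_anti bg_le_trans.

End PosetOfBigraph.

Section FlagIdeal.
Variables (K : fieldType) (d : Order.disp_t) (P : finPOrderType d).

Definition chain (C : {set P}) : bool :=
  [forall x in C, [forall y in C, (x >=< y)%O]].

Definition maximal_chain (C : {set P}) : bool := maxset chain C.

(* The variable x_p is 'X_(enum_rank p). *)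
Definition chain_monomial (C : {set P}) : {mpoly K[#|P|]} :=
  \prod_(p in C) 'X_(enum_rank p).

Definition flag_ideal : {mpoly K[#|P|]} -> Prop := fun f =>
  exists c : {set P} -> {mpoly K[#|P|]},
    f = \sum_(C : {set P} | maximal_chain C) c C * chain_monomial C.

End FlagIdeal.

Section Resolution.
Variables (K : fieldType) (n : nat).
Local Notation S := {mpoly K[n]}.

(* Entry of a degree-preserving map S(-a) -> S(-b), with the standard
   grading of S. *)
Definition graded_entry (a b : nat) (f : S) : Prop :=
  if (b <= a)%N then is_true (f \is (a - b).-homog) else f = 0.

(* A graded free resolution ... -> F_1 -> F_0 -> I -> 0 by free modules of
   finite rank, F_i being the direct sum of the S(-fr_shift i j) for
   j < fr_rank i.  Elements of F_i are row vectors and maps act on the right.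
   Only nonnegative shifts are allowed: an ideal lives in nonnegative degrees,
   so these are the only ones that occur in minimal resolutions. *)
Record free_resolution (I : S -> Prop) := FreeResolution {
  fr_rank : nat -> nat;
  fr_shift : forall i, 'I_(fr_rank i) -> nat;
  fr_diff : forall i, 'M[S]_(fr_rank i.+1, fr_rank i);
  fr_aug : 'cV[S]_(fr_rank 0);
  fr_diff_graded : forall i r s,
    graded_entry (fr_shift r) (fr_shift s) (fr_diff i r s);
  fr_aug_graded : forall r, fr_aug r ord0 \is (fr_shift r).-homog;
  fr_aug_image : forall f : S,
    I f <-> exists v : 'rV[S]_(fr_rank 0), f = (v *m fr_aug) ord0 ord0;
  fr_exact0 : forall v : 'rV[S]_(fr_rank 0),
    v *m fr_aug = 0 <-> exists w, v = w *m fr_diff 0;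
  fr_exact : forall i (v : 'rV[S]_(fr_rank i.+1)),
    v *m fr_diff i = 0 <-> exists w, v = w *m fr_diff i.+1
}.

(* The differentials have their entries in the ideal (x_1, ..., x_n). *)
Definition fr_minimal (I : S -> Prop) (F : free_resolution I) : Prop :=
  forall i r s, (fr_diff F i r s)@_0%MM = 0.

Definition fr_linear (I : S -> Prop) (F : free_resolution I) : Prop :=
  exists d : nat, forall i (j : 'I_(fr_rank F i)), fr_shift j = (d + i)%N.

(* Minimal graded free resolutions are unique up to isomorphism, so it does
   not matter which one is considered. *)
Definition has_linear_resolution (I : S -> Prop) : Prop :=
  exists F : free_resolution I, fr_minimal F /\ fr_linear F.

End Resolution.

Section GraphNotions.
Variable G : bigraph.

Definition induced_edges (W : {set G}) : {set {set G}} :=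
  [set [set u; v] | u in W, v in W & edge u v].

Definition has_induced_two_disjoint_edges : Prop :=
  exists p1 p2 q1 q2 : G,
    [/\ p1 \in partA G /\ p2 \in partA G,
        q1 \in partB G /\ q2 \in partB G,
        uniq [:: p1; p2; q1; q2] &
        induced_edges [set p1; p2; q1; q2] = [set [set p1; q1]; [set p2; q2]]].

(* The vertices are labelled x_0, ..., x_n and y_0, ..., y_m, so that both
   vertex sets are nonempty, as the last two conditions presuppose.  The
   labelled classes are not required to be partA and partB in this order. *)
Definition is_Ferrers : Prop :=
  exists (n m : nat) (x : 'I_n.+1 -> G) (y : 'I_m.+1 -> G),
    [/\ [/\ injective x, injective y, forall i j, x i != y j &
            forall v, (exists i, v = x i) \/ (exists j, v = y j)],
        (forall i i', ~~ edge (x i) (x i')) /\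
        (forall j j', ~~ edge (y j) (y j')),
        forall (p i : 'I_n.+1) (q j : 'I_m.+1), edge (x p) (y q) ->
          (i <= p)%N -> (j <= q)%N -> edge (x i) (y j) &
        edge (x ord0) (y ord_max) /\ edge (x ord_max) (y ord0)].

End GraphNotions.

(* Main.v *)
Require Import Defs.
From HB Require Import structures.
From mathcomp Require Import all_boot all_order all_algebra.
From mathcomp Require Import mpoly.
From Stdlib Require Import IndefiniteDescription.


(** (1) => (2): let p1 q1 and p2 q2 be two disjoint edges inducing no further
    edge.  The Koszul relation between x_p1 x_q1 and x_p2 x_q2 is not generated
    by linear syzygies: the coefficient of x_p2 x_q2 in the component at the
    generator x_p1 x_q1 is a functional which vanishes on the multiples of the
    linear syzygies, since p1 q1 is the only edge in {p1, q1, p2} and in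
    {p1, q1, q2}, but not on the Koszul relation.

    (2) => (3): the neighbourhoods of the vertices of each part are nested, so
    sorting each part by decreasing degree gives the Ferrers labelling.

    (3) => (1): in lexicographic order the generators x_i y_j have linear
    quotients, the colon ideals being generated by the variables x_a, a < i and
    y_b, b < j.  Adding generators one by one, the horseshoe lemma glues linear
    resolutions of the previous ideal and of the quotient by the variables; the
    Koszul complexes resolving the latter arise by the same construction. *)

Set Implicit Arguments.
Unset Strict Implicit.
Unset Printing Implicit Defensive.

Import Order.TTheory GRing.Theory.

Local Open Scope ring_scope.

(** * Linear resolutions and linear quotients *)

Section LinearResolutions.
Variables (K : fieldType) (n : nat).
Local Notation S := {mpoly K[n]}.

(** * Homogeneous components and lifts with linear entries *)

Lemma pihomogM d e (f g : S) : g \is e.-homog ->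
  pihomog mdeg (d + e) (f * g) = pihomog mdeg d f * g.
Proof.
(* The bound [k] exceeds both [d] and all degrees in [f], so degree [d] occurs in the decomposition
   even if that component is zero. *)
move=> g_homog; pose k := maxn d.+1 (msize f).
have dk : (d < k)%N by rewrite leq_max leqnn.
rewrite {1}(pihomog_partitionE (mf := mdeg) (leq_maxr d.+1 (msize f))).
rewrite big_distrl /= linear_sum /= (bigD1 (Ordinal dk)) //= [X in _ + X]big1.
  by rewrite addr0 pihomog_dE // dhomogM ?pihomogP.
move=> i /eqP i_d; apply: (pihomog_ne0 (d := (i + e)%N)).
  by rewrite eqn_add2r; apply/eqP => id; apply: i_d; apply: val_inj.
by rewrite dhomogM ?pihomogP.
Qed.

Definition homog_mx d p q (A : 'M[S]_(p, q)) := forall i j, A i j \is d.-homog.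

Definition exact_at q p m (D' : 'M[S]_(q, p)) (D : 'M[S]_(p, m)) :=
  forall v : 'rV[S]_p, v *m D = 0 <-> exists w, v = w *m D'.

Lemma homog_mulmx d e p q r (A : 'M[S]_(p, q)) (B : 'M[S]_(q, r)) :
  homog_mx d A -> homog_mx e B -> homog_mx (d + e) (A *m B).
Proof.
move=> hA hB i j; rewrite mxE rpred_sum // => k _.
by rewrite dhomogM.
Qed.

Lemma homog_oppmx d p q (A : 'M[S]_(p, q)) : homog_mx d A -> homog_mx d (- A).
Proof. by move=> hA i j; rewrite mxE rpredN. Qed.

(** Any coefficients [u] may be cut down to their degree-one components: as [A] is homogeneous, the
    other components contribute nothing in degree [1 + e]. *)
Lemma homog_mx_lift e p m k (A : 'M[S]_(p, m)) (B : 'M[S]_(k, m)) :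
  homog_mx e A -> homog_mx (1 + e) B ->
  (forall i, exists u, row i B = u *m A) ->
  exists2 X : 'M[S]_(k, p), homog_mx 1 X & X *m A = B.
Proof.
move=> hA hB /fin_all_exists[u uA].
exists (\matrix_(i, j) pihomog mdeg 1 (u i ord0 j)) => [i j|].
  by rewrite mxE pihomogP.
apply/matrixP => i j; rewrite mxE -[RHS](@pihomog_dE _ _ mdeg (1 + e)) //.
have -> : B i j = row i B ord0 j by rewrite mxE.
rewrite uA mxE linear_sum /=; apply: eq_bigr => l _.
by rewrite mxE pihomogM.
Qed.

(* The greatest predicate such that [D] has linear entries and its kernel is
   the image of a matrix of the same kind. *)
Definition lin_resolved q p (D : 'M[S]_(q, p)) : Prop :=
  exists R : forall q p, 'M[S]_(q, p) -> Prop,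
    (forall q p (D : 'M[S]_(q, p)), R q p D -> homog_mx 1 D /\
       exists q' (D' : 'M[S]_(q', q)), exact_at D' D /\ R q' q D') /\ R q p D.

Lemma lin_resolved_linear q p (D : 'M[S]_(q, p)) :
  lin_resolved D -> homog_mx 1 D.
Proof. by case=> R [RP /RP[]]. Qed.

Lemma lin_resolved_next q p (D : 'M[S]_(q, p)) : lin_resolved D ->
  exists q' (D' : 'M[S]_(q', q)), exact_at D' D /\ lin_resolved D'.
Proof.
case=> R [RP /RP[_ [q' [D' [ex RD']]]]].
by exists q', D'; split=> //; exists R.
Qed.

(** A greatest fixed point is closed under its own unfolding; the invariant is one step followed by
    [lin_resolved]. *)
Lemma lin_resolved_cons r q p (D' : 'M[S]_(r, q)) (D : 'M[S]_(q, p)) :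
  homog_mx 1 D -> exact_at D' D -> lin_resolved D' -> lin_resolved D.
Proof.
move=> linD ex rD'.
exists (fun q p (D : 'M[S]_(q, p)) => homog_mx 1 D /\
  exists r (D' : 'M[S]_(r, q)), exact_at D' D /\ lin_resolved D').
split; last by split=> //; exists r, D'.
move=> {linD ex rD'}q {}p {}D [linD [{}r [{}D' [ex rD']]]]; split=> //.
exists r, D'; split=> //; split; first exact: lin_resolved_linear.
exact: lin_resolved_next.
Qed.

Lemma lin_resolved0 p (D : 'M[S]_(0, p)) : lin_resolved D.
Proof.
exists (fun q _ _ => q = 0%N); split=> // q {}p {}D q0.
subst q; split=> [[]//|]; exists 0%N, 0; split=> // v.
by rewrite thinmx0 mul0mx; split=> // _; exists 0; rewrite mul0mx.
Qed.

(** * The horseshoe lemma by coinduction *)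

(** This is the coinductive invariant: the last condition, that [X] sends the kernel of [DC] into
    the image of [DA], is what makes the next off-diagonal block exist. *)
Inductive horseshoe : forall q p, 'M[S]_(q, p) -> Prop :=
  Horseshoe qA qC pA pC (DA : 'M[S]_(qA, pA)) (DC : 'M[S]_(qC, pC))
    (X : 'M[S]_(qC, pA)) of lin_resolved DA & lin_resolved DC &
    homog_mx 1 X &
    (forall v : 'rV_qC, v *m DC = 0 -> exists u, v *m X = u *m DA) :
    horseshoe (block_mx DA 0 X DC).

Lemma exact_mul0 q p m (D' : 'M[S]_(q, p)) (D : 'M[S]_(p, m)) :
  exact_at D' D -> D' *m D = 0.
Proof.
move=> ex; apply/row_matrixP => i; rewrite row_mul row0; apply/ex.
by exists (delta_mx ord0 i); rewrite rowE.
Qed.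

(** Diagram chase: the right part of a cycle lifts through [DC'], and subtracting the contribution
    of [X'] leaves a cycle of [DA]. The equation on [X'] says that the composite vanishes. *)
Lemma exact_block qA qC pA pC mA mC
    (DA' : 'M[S]_(qA, pA)) (DA : 'M[S]_(pA, mA))
    (DC' : 'M[S]_(qC, pC)) (DC : 'M[S]_(pC, mC))
    (X' : 'M[S]_(qC, pA)) (X : 'M[S]_(pC, mA)) :
  exact_at DA' DA -> exact_at DC' DC -> X' *m DA = - (DC' *m X) ->
  exact_at (block_mx DA' 0 X' DC') (block_mx DA 0 X DC).
Proof.
move=> exA exC XE v; split=> [|[w ->]].
  rewrite -{1}[v]hsubmxK mul_row_block mulmx0 add0r -row_mx0.
  case/eq_row_mx => eA /exC[w wE].
  have /exA[u uE] : (lsubmx v - w *m X') *m DA = 0.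
    by rewrite mulmxBl -mulmxA XE mulmxN opprK mulmxA -wE.
  exists (row_mx u w); rewrite mul_row_block mulmx0 add0r -wE -uE subrK.
  by rewrite hsubmxK.
rewrite -[w]hsubmxK -mulmxA mulmx_block !mul0mx !mulmx0 !addr0 !add0r XE addNr.
rewrite (exact_mul0 exA) (exact_mul0 exC).
by rewrite mul_row_block !mulmx0 !addr0 row_mx0.
Qed.

Lemma horseshoe_lin_resolved q p (D : 'M[S]_(q, p)) :
  horseshoe D -> lin_resolved D.
Proof.
move=> hD; exists horseshoe; split=> // {hD}q {}p {}D.
case: q p D / => qA qC pA pC DA DC X rA rC linX hX.
have [linA linC] := (lin_resolved_linear rA, lin_resolved_linear rC).
split.
  move=> i j; rewrite mxE; case: split => k; rewrite mxE; case: split => l //.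
  by rewrite mxE rpred0.
have [qA' [DA' [exA rA']]] := lin_resolved_next rA.
have [qC' [DC' [exC rC']]] := lin_resolved_next rC.
have linC' := lin_resolved_linear rC'.
(* Rows of [DC'] lie in the kernel of [DC], so [X] sends them into the image of [DA]. *)
have [|i|X' linX' X'E] := homog_mx_lift (B := - (DC' *m X)) linA.
- exact/homog_oppmx/homog_mulmx.
- have /hX[u uE] : row i DC' *m DC = 0 by rewrite -row_mul (exact_mul0 exC) row0.
  by exists (- u); rewrite mulNmx -uE -row_mul linearN.
exists _, (block_mx DA' 0 X' DC'); split; first exact: exact_block.
split=> // v vC; apply/exA.
by rewrite -mulmxA X'E mulmxN mulmxA vC mul0mx oppr0.
Qed.

(** * Ideals with a linear resolution *)

(** The tail of the resolution is hidden in [lin_resolved], so the inductions need no infinite data.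
    Minimality comes for free, linear entries having no constant term. *)
Definition linres d (I : S -> Prop) : Prop :=
  exists p (g : 'cV[S]_p), [/\ homog_mx d g,
    (forall f : S, I f <-> exists v : 'rV_p, f%:M = v *m g) &
    exists q (D : 'M[S]_(q, p)), exact_at D g /\ lin_resolved D].

Lemma linres_ext d (I J : S -> Prop) :
  (forall f, I f <-> J f) -> linres d I -> linres d J.
Proof.
move=> IJ [p [g [hg gI res]]]; exists p, g; split=> // f.
by split=> [/IJ/gI|/gI/IJ].
Qed.

Lemma linres0 d : linres d (fun f => f = 0).
Proof.
exists 0%N, 0; split=> [[]//|f|].
  split=> [->|[v]].
    by exists 0; rewrite mulmx0 raddf0.
  by move/matrixP/(_ ord0 ord0); rewrite mulmx0 !mxE eqxx.
exists 0%N, 0; split; last exact: lin_resolved0.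
by move=> v; rewrite thinmx0 mul0mx; split=> // _; exists 0; rewrite mul0mx.
Qed.

(* Adding one generator [m] whose colon ideal [J] is generated by linear forms:
   the sequence 0 -> I -> I + (m) -> (S / J)(-d) -> 0 is resolved by the
   horseshoe lemma. *)
Lemma linres_add d (I J : S -> Prop) (m : S) :
  linres d I -> linres 1 J -> m \is d.-homog -> (forall c, I (c * m) <-> J c) ->
  linres d (fun f => exists c, I (f - c * m)).
Proof.
move=> [p [g [hg gI [q [D [exD rD]]]]]] [k [V [hV VJ [l [E [exE rE]]]]]] hm colon.
have [|i|X linX XE] := homog_mx_lift (B := - (m *: V)) hg.
- by apply: homog_oppmx => i j; rewrite mxE addnC dhomogM.
- have /colon/gI[v vE] : J (V i ord0).
    apply/VJ; exists (delta_mx ord0 i); apply/matrixP => a b.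
    by rewrite -rowE !mxE !ord1 eqxx.
  exists (- v); rewrite mulNmx -vE; apply/matrixP => a b.
  by rewrite !mxE !ord1 eqxx mulrC.
pose G : 'cV[S]_(p + 1) := col_mx g m%:M.
exists (p + 1)%N, G; split=> [i j|f|].
- rewrite mxE; case: split => a; rewrite ?mxE //.
  by rewrite !ord1 eqxx.
- split=> [[c /gI[v vE]]|[v]].
    exists (row_mx v c%:M); rewrite mul_row_col -vE -scalar_mxM -raddfD /=.
    by rewrite subrK.
  rewrite -[v]hsubmxK mul_row_col [rsubmx v]mx11_scalar -scalar_mxM => vE.
  exists (rsubmx v ord0 ord0); apply/gI; exists (lsubmx v).
  by rewrite raddfB /= vE addrK.
(* The upper rows are the old syzygies; a lower row has a generator of [J] as coefficient of [m] and
   in [X] the old coefficients cancelling it. *)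
exists _, (block_mx D 0 X V); split.
  move=> v; rewrite -{1}[v]hsubmxK mul_row_col.
  rewrite [rsubmx v]mx11_scalar -scalar_mxM; set c := rsubmx v _ _.
  have cE : c%:M = rsubmx v by rewrite [rsubmx v]mx11_scalar.
  split.
    move/eqP; rewrite addr_eq0 => /eqP vE.
    have /VJ[w wE] : J c.
      by apply/colon/gI; exists (- lsubmx v); rewrite mulNmx vE opprK.
    have /exD[u uE] : (lsubmx v - w *m X) *m g = 0.
      rewrite mulmxBl vE -mulmxA XE mulmxN opprK -scalemxAr -wE.
      by rewrite scale_scalar_mx mulrC addNr.
    exists (row_mx u w); rewrite mul_row_block mulmx0 add0r -uE subrK -wE cE.
    by rewrite hsubmxK.
  case=> w vE; have := vE; rewrite -[w]hsubmxK mul_row_block mulmx0 add0r.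
  rewrite -{1}[v]hsubmxK => /eq_row_mx[-> cwE].
  rewrite mulmxDl -[_ *m D *m g]mulmxA (exact_mul0 exD) mulmx0 add0r -mulmxA XE mulmxN.
  by rewrite -scalemxAr -cwE -cE scale_scalar_mx [m * c]mulrC addNr.
apply: horseshoe_lin_resolved; split=> //; first exact: lin_resolved_cons rE.
by move=> v vV; apply/exD; rewrite -mulmxA XE mulmxN -scalemxAr vV scaler0 oppr0.
Qed.


Record resolved_matrix := ResolvedMatrix {
  rm_cols : nat;
  rm_rows : nat;
  rm_mx : 'M[S]_(rm_rows, rm_cols);
  rm_resolved : lin_resolved rm_mx
}.

(** The fields of [free_resolution] are functions, so each next matrix must be chosen as data before
    the choice can be iterated. *)
Lemma lin_resolved_sig q p (D : 'M[S]_(q, p)) : lin_resolved D ->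
  {r : nat & {D' : 'M[S]_(r, q) | exact_at D' D & lin_resolved D'}}.
Proof.
move/lin_resolved_next/constructive_indefinite_description=> [r].
case/constructive_indefinite_description=> D' [ex rD'].
by exists r, D'.
Qed.

Definition rm_next (M : resolved_matrix) : resolved_matrix :=
  let N := projT2 (lin_resolved_sig (rm_resolved M)) in
  @ResolvedMatrix (rm_rows M) _ (s2val N) (s2valP' N).

Lemma linres_has_linear_resolution d (I : S -> Prop) :
  linres d I -> has_linear_resolution I.
Proof.
move=> [p [g [hg gI [q [D [exD rD]]]]]].
pose M i := iter i rm_next (ResolvedMatrix rD).
pose rank i := rm_cols (M i).
pose diff i : 'M[S]_(rank i.+1, rank i) := rm_mx (M i).
have linD i : homog_mx 1 (diff i) by exact: lin_resolved_linear (rm_resolved _).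
have exD' i : exact_at (diff i.+1) (diff i).
  exact: (s2valP (projT2 (lin_resolved_sig (rm_resolved (M i))))).
have graded i r s : graded_entry (d + i.+1) (d + i) (diff i r s).
  by rewrite /graded_entry leq_add2l leqnSn subnDl subSnn; apply: linD.
have gI' f : I f <-> exists v : 'rV_(rank 0), f = (v *m g) ord0 ord0.
  rewrite gI; split=> -[v vE]; exists v; last by rewrite [v *m g]mx11_scalar -vE.
  by rewrite -vE mxE eqxx.
pose F := @FreeResolution K n I rank (fun i _ => d + i)%N diff g graded.
have hg' r : g r ord0 \is (d + 0).-homog by rewrite addn0.
exists (F hg' gI' exD exD'); split; last by exists d.
move=> i r s; apply: (dhomog_nemf_coeff (linD i r s)).
by rewrite /= mdeg0.
Qed.

(** * Monomial ideals and their colon ideals *)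

(** Membership in a monomial ideal is tested monomial by monomial; taking this as definition avoids
    coefficients and allows any predicate of generators. *)
Definition mideal (G : 'X_{1..n} -> Prop) (f : S) : Prop :=
  forall m, m \in msupp f -> exists2 t, G t & (t <= m)%MM.

Lemma eq_mideal (G H : 'X_{1..n} -> Prop) :
  (forall t, G t <-> H t) -> forall f, mideal G f <-> mideal H f.
Proof.
by move=> GH f; split=> hf m /hf[t /GH Gt tm]; exists t.
Qed.

Lemma mideal0 (G : 'X_{1..n} -> Prop) (f : S) :
  (forall t, ~ G t) -> mideal G f <-> f = 0.
Proof.
move=> G0; split=> [hf|-> m]; last by rewrite msupp0.
apply/eqP; rewrite -msupp_eq0; case E: (msupp f) => [|m s] //.
by have [|t /G0] := hf m; rewrite // E mem_head.
Qed.

Lemma mideal_add (G : 'X_{1..n} -> Prop) t0 (f : S) :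
  mideal (fun t => G t \/ t = t0) f <->
  exists c, mideal G (f - c * 'X_[t0]).
Proof.
split=> [hf|[c hc] m].
  (* The terms divisible by [t0], divided by it; the remaining terms must be covered by [G]. *)
  exists (\sum_(m <- msupp f | (t0 <= m)%MM) f@_m *: 'X_[m - t0]).
  rewrite {1}(mpolyE f) mulr_suml.
  rewrite [X in _ - X](eq_bigr (fun m => f@_m *: 'X_[m])); last first.
    by move=> m t0m; rewrite -scalerAl -mpolyXD submK.
  rewrite (bigID (fun m => t0 <= m)%MM) /= [X in X - _]addrC addrK => m.
  move=> m_supp; have : (m \in msupp f) && ~~ (t0 <= m)%MM.
    apply: contraLR m_supp => m0.
    rewrite mcoeff_msupp negbK raddf_sum /= big_seq_cond big1 // => k /andP[kf t0k].
    rewrite mcoeffZ mcoeffX; case: eqP => [km|]; last by rewrite mulr0.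
    by rewrite -km kf t0k in m0.
  case/andP=> /hf[t [Gt|->] tm]; last by rewrite tm.
  by exists t.
rewrite mcoeff_msupp => fm.
have [m0|] := boolP (m \in msupp (f - c * 'X_[t0])).
  by have [t Gt tm] := hc m m0; exists t => //; left.
rewrite mcoeff_msupp negbK mcoeffB subr_eq0 => /eqP fE.
move: fm; rewrite fE -mcoeff_msupp (perm_mem (msuppMX _ _)).
by case/mapP=> k _ ->; exists t0; [right|rewrite lem_addr].
Qed.

(** Multiplication by a monomial merely translates the support, so the colon ideal can be computed
    on monomials. *)
Lemma mideal_colon (G H : 'X_{1..n} -> Prop) t0 (c : S) :
  (forall k, (exists2 t, G t & (t <= k + t0)%MM) <->
             (exists2 t, H t & (t <= k)%MM)) ->
  mideal G (c * 'X_[t0]) <-> mideal H c.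
Proof.
move=> GH; split=> hc k.
  by rewrite mcoeff_msupp -(mcoeffMX c t0) -mcoeff_msupp => /hc; rewrite addmC => /GH.
by rewrite (perm_mem (msuppMX _ _)) => /mapP[l lc ->]; rewrite addmC; apply/GH/hc.
Qed.

Lemma linres_mideal_add d (G H : 'X_{1..n} -> Prop) t0 :
  linres d (mideal G) -> linres 1 (mideal H) -> mdeg t0 = d ->
  (forall k, (exists2 t, G t & (t <= k + t0)%MM) <->
             (exists2 t, H t & (t <= k)%MM)) ->
  linres d (mideal (fun t => G t \/ t = t0)).
Proof.
move=> rG rH dt0 GH.
apply: linres_ext (linres_add (m := 'X_[t0]) rG rH _ _) => [f||c].
- by rewrite mideal_add.
- by rewrite dhomogX /= dt0.
- exact: mideal_colon.
Qed.

Lemma linres_mideal0 d (G : 'X_{1..n} -> Prop) :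
  (forall t, ~ G t) -> linres d (mideal G).
Proof.
by move=> G0; apply: linres_ext (linres0 d) => f; rewrite mideal0.
Qed.

(* The Koszul complex, obtained by adding one variable at a time. *)
Lemma linres_variables (s : seq 'I_n) :
  linres 1 (mideal (fun t => exists2 i, i \in s & t = U_(i)%MM)).
Proof.
elim: s => [|i s IHs]; first by apply: linres_mideal0 => t [].
have [i_s|i_s] := boolP (i \in s).
  apply: linres_ext IHs; apply: eq_mideal => t.
  split=> -[j js ->]; exists j => //; first by rewrite inE js orbT.
  by move: js; rewrite inE => /predU1P[->|].
(* A variable outside [s] is a nonzerodivisor modulo those in [s], so the ideal is its own colon
   ideal. *)
have := linres_mideal_add IHs IHs (mdeg1 i) _; move=> H.
apply: linres_ext (H _).
  apply: eq_mideal => t; split=> [[[j js ->]|->]|[j]].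
  - by exists j; rewrite // inE js orbT.
  - by exists i; rewrite // mem_head.
  - by rewrite inE => /predU1P[-> ->|js ->]; [right|left; exists j].
move=> k; split=> -[_ [j js ->] jk]; exists U_(j)%MM; try by exists j.
  move: jk; rewrite !lep1mP mnmDE mnm1E; case: (i =P j) => [ij|_]; last by rewrite addn0.
  by rewrite ij js in i_s.
exact: lepm_trans jk (lem_addr _ _).
Qed.

(** * Linear quotients for Ferrers graphs *)

Section Ferrers.
Variables (N M : nat) (x : 'I_N -> 'I_n) (y : 'I_M -> 'I_n).
Variable e : 'I_N -> 'I_M -> bool.
Hypotheses (x_inj : injective x) (y_inj : injective y).
Hypothesis xy : forall i j, x i != y j.
Hypothesis e_ferrers : forall (p i : 'I_N) (q j : 'I_M),
  e p q -> (i <= p)%N -> (j <= q)%N -> e i j.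

(** The edges lexicographically before [(i, j)]. The bounds are natural numbers so that they can
    reach [N] and [M], past the last index. *)
Definition lex_gens (i j : nat) (t : 'X_{1..n}) : Prop :=
  exists a b, [/\ e a b, (a < i)%N \/ a = i :> nat /\ (b < j)%N &
                  t = (U_(x a) + U_(y b))%MM].

(** If an earlier [x a], [y b] divides [k] times the new generator, then [x a] (when [a < i]) or
    [y b] (when [a = i]) divides [k]. Conversely, the Ferrers condition makes [x a], [y j] and
    [x i], [y b] earlier generators. *)
Lemma lex_gens_colon (i : 'I_N) (j : 'I_M) k : e i j ->
  (exists2 t, lex_gens i j t & (t <= k + (U_(x i) + U_(y j)))%MM) <->
  (exists2 t, (exists2 v,
     v \in [seq x a | a : 'I_N <- enum 'I_N & (a < i)%N] ++
           [seq y b | b : 'I_M <- enum 'I_M & (b < j)%N] & t = U_(v)%MM) & (t <= k)%MM).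
Proof.
move=> eij; split=> [[_ [a [b [eab ab ->]]] le_t]|[_ [v vs ->] vk]].
  case: ab => [ai|[/val_inj ai bj]].
    exists U_(x a)%MM.
      by exists (x a); rewrite // mem_cat map_f // mem_filter ai mem_enum.
    have := lepm_trans (lem_addr _ _) le_t.
    have ia : (i == a) = false by rewrite -(inj_eq val_inj) gtn_eqF.
    rewrite !lep1mP !mnmDE !mnm1E (inj_eq x_inj) ia.
    by rewrite [y j == _]eq_sym (negPf (xy a j)) !addn0.
  exists U_(y b)%MM.
    by exists (y b); rewrite // mem_cat orbC map_f // mem_filter bj mem_enum.
  have := lepm_trans (lem_addl _ _) le_t.
  have jb : (j == b) = false by rewrite -(inj_eq val_inj) gtn_eqF.
  by rewrite !lep1mP !mnmDE !mnm1E (inj_eq y_inj) (negPf (xy i b)) jb !addn0.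
move: vs; rewrite mem_cat => /orP[] /mapP[a]; rewrite mem_filter => /andP[lt_a _] vE.
  exists (U_(x a) + U_(y j))%MM.
    by exists a, j; split=> //; [exact: e_ferrers eij (ltnW _) _|left].
  rewrite vE in vk; apply/mnm_lepP => l; rewrite !mnmDE addnA leq_add2r.
  by apply: leq_trans (mnm_lepP vk l) _; rewrite leq_addr.
exists (U_(x i) + U_(y a))%MM.
  by exists i, a; split=> //; [exact: e_ferrers eij _ (ltnW _)|right].
rewrite vE in vk; apply/mnm_lepP => l; rewrite !mnmDE.
rewrite [(k l + _)%N]addnCA leq_add2l.
by apply: leq_trans (mnm_lepP vk l) _; rewrite leq_addr.
Qed.

Lemma lex_gensS (i : 'I_N) (j : 'I_M) t :
  lex_gens i j.+1 t <->
  lex_gens i j t \/ e i j /\ t = (U_(x i) + U_(y j))%MM.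
Proof.
split=> [[a [b [eab ab tE]]]|[[a [b [eab ab tE]]]|[eij tE]]]; last first.
- by exists i, j; split=> //; right.
- by exists a, b; split=> //; case: ab => [|[ai bj]]; [left|right; rewrite ltnS ltnW].
case: ab => [ai|[/val_inj ai]]; first by left; exists a, b; split=> //; left.
rewrite ltnS leq_eqVlt => /predU1P[/val_inj bj|bj].
  by right; rewrite -ai -bj.
by left; exists a, b; split=> //; right; rewrite ai.
Qed.

Lemma linres_lex_gens i j : (i < N)%N -> (j <= M)%N ->
  linres 2 (mideal (lex_gens i 0)) -> linres 2 (mideal (lex_gens i j)).
Proof.
move=> iN + r0; elim: j => // j IHj jM.
have /= lexS := lex_gensS (Ordinal iN) (Ordinal jM).
have [eij|eij] := boolP (e (Ordinal iN) (Ordinal jM)); last first.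
  apply: linres_ext (IHj (ltnW jM)); apply: eq_mideal => t; rewrite lexS.
  by split=> [|[//|[]]]; [left|rewrite (negPf eij)].
have := linres_mideal_add (IHj (ltnW jM)) (linres_variables _) _
  (fun k => lex_gens_colon k eij).
rewrite mdegD !mdeg1 => /(_ erefl); apply: linres_ext.
apply: eq_mideal => t; rewrite lexS.
by split=> -[|tE]; [left|right|left|right; case: tE].
Qed.

Lemma linres_ferrers : linres 2 (mideal
  (fun t => exists i j, e i j /\ t = (U_(x i) + U_(y j))%MM)).
Proof.
suff: linres 2 (mideal (lex_gens N 0)).
  apply/linres_ext/eq_mideal => t; split=> [[a [b [eab _ tE]]]|[a [b [eab tE]]]].
    by exists a, b.
  by exists a, b; split=> //; left.
elim: {-2}N (leqnn N) => [_|i IHi iN].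
  by apply: linres_mideal0 => t [a [b [_ [|[]]]]].
have := linres_lex_gens iN (leqnn M) (IHi (ltnW iN)).
(* The completed row [lex_gens i M] is the start [lex_gens i.+1 0] of the next one. *)
apply/linres_ext/eq_mideal => t; split=> -[a [b [eab ab tE]]]; exists a, b.
  by split=> //; left; rewrite ltnS; case: ab => [/ltnW|[->]].
split=> //; case: ab => [|[]] //; rewrite ltnS leq_eqVlt => /predU1P[->|ai].
  by right.
by left.
Qed.
End Ferrers.
End LinearResolutions.

(** * Coefficients of combinations and products *)

Lemma mideal_gens (K : fieldType) (n : nat) (T : finType) (Q : pred T)
    (m : T -> 'X_{1..n}) (f : {mpoly K[n]}) :
  (exists c : T -> {mpoly K[n]}, f = \sum_(C | Q C) c C * 'X_[m C]) <->
  mideal (fun t => exists2 C, Q C & t = m C) f.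
Proof.
split=> [[c ->] k|hf].
  rewrite mcoeff_msupp raddf_sum /= => nz.
  have [C QC] : exists2 C, Q C & (c C * 'X_[m C])@_k != 0.
    apply/exists_inP; apply: contraR nz; rewrite negb_exists_in => /forall_inP z.
    by rewrite big1 // => C QC; apply/eqP; rewrite -[_ == _]negbK z.
  rewrite -mcoeff_msupp (perm_mem (msuppMX _ _)) => /mapP[l _ ->].
  by exists (m C); [exists C|rewrite lem_addr].
(* Each monomial is assigned to a single generator dividing it, so that no term is counted twice. *)
pose pm k := [pick C | Q C & (m C <= k)%MM].
exists (fun C => \sum_(k <- msupp f | pm k == Some C) f@_k *: 'X_[k - m C]).
under eq_bigr => C QC do rewrite mulr_suml.
rewrite (exchange_big_dep predT) //= {1}(mpolyE f); apply: eq_big_seq => k kf.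
have [_ [C QC ->] Ck] := hf k kf.
have : pm k != None by rewrite /pm; case: pickP => // /(_ C); rewrite QC Ck.
case pmk: (pm k) => [D|] // _.
have /andP[QD Dk] : Q D && (m D <= k)%MM.
  by move: pmk; rewrite /pm; case: pickP => // E QE [<-].
rewrite (big_pred1 D) => [|E]; first by rewrite -scalerAl -mpolyXD submK.
rewrite (inj_eq Some_inj) [D == E]eq_sym andbC /=.
by have [->|] := eqVneq E D.
Qed.

Lemma mcoeffM_unique (K : fieldType) (n : nat) (f g : {mpoly K[n]}) u m :
  (forall k l, (k + l = u + m)%MM -> k != u -> f@_k * g@_l = 0) ->
  (f * g)@_(u + m) = f@_u * g@_m.
Proof.
move=> fg0; rewrite mcoeffM.
have du : (mdeg u < (mdeg (u + m)).+1)%N by rewrite ltnS mdegD leq_addr.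
have dm : (mdeg m < (mdeg (u + m)).+1)%N by rewrite ltnS mdegD leq_addl.
rewrite (bigD1 (BMultinom du, BMultinom dm)) //= [X in _ + X]big1 ?addr0 //.
move=> [k l] /= /andP[/eqP kl ne]; apply: fg0 => //.
apply: contraNneq ne => ku; have lm : l = m :> 'X_{1..n}.
  by move: kl; rewrite ku => /addmI.
by apply/eqP; congr pair; apply: val_inj.
Qed.

Lemma linear_formE (K : fieldType) (n : nat) (f : {mpoly K[n]}) :
  f \is 1.-homog -> f = \sum_i f@_U_(i) *: 'X_i.
Proof.
move=> f1; apply/mpolyP => m; rewrite raddf_sum /=.
under eq_bigr => i _ do rewrite mcoeffZ mcoeffX.
have [/mdeg1P[j /eqP ->]|m1] := boolP (mdeg m == 1%N).
  rewrite (bigD1 j) //= eqxx mulr1 big1 ?addr0 // => i ij.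
  by rewrite eq_mnm1 (negPf ij) mulr0.
rewrite (dhomog_nemf_coeff f1) // big1 // => i _.
have [Uim|_] := eqVneq U_(i)%MM m; last by rewrite mulr0.
by rewrite -Uim mdeg1 in m1.
Qed.

Lemma mcoeffMX_eq0 (K : fieldType) (n : nat) (f : {mpoly K[n]}) m k :
  ~~ (m <= k)%MM -> (f * 'X_[m])@_k = 0.
Proof.
move=> mk; apply: memN_msupp_eq0; rewrite (perm_mem (msuppMX _ _)).
by apply: contra mk => /mapP[l _ ->]; rewrite lem_addr.
Qed.

(** * Flag ideals of bipartite graphs *)

Section BipartiteFlagIdeal.
Variable P : bigraph.
Hypotheses (P_nonempty : (0 < #|P|)%N) (P_no_isolated : no_isolated P).

(** * Maximal chains are edges *)

Lemma edge_neq (u v : P) : edge u v -> u != v.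
Proof. by apply: contraTneq => ->; rewrite edge_irr. Qed.

Lemma partAB (u : P) : (u \in partB P) = (u \notin partA P).
Proof.
have := in_setT u; rewrite -part_cover inE.
have := @bg_AB P u; case: (u \in partA P); case: (u \in partB P) => //.
by move=> H; case: H.
Qed.

Lemma edge_partA (u v : P) : edge u v -> (u \in partA P) = (v \notin partA P).
Proof.
by move/edge_parts; rewrite !partAB; case: (u \in _); case: (v \in _).
Qed.

Lemma edge_triangle_free (u v w : P) : edge u v -> edge w u -> ~~ edge w v.
Proof.
move=> /edge_partA uv /edge_partA wu; apply/negP => /edge_partA.
by rewrite wu uv; case: (v \in _).
Qed.

Lemma comparable_edge (u v : poset_of P) :
  (u >=< v)%O = (u == v) || edge (u : P) v.
Proof.
have leE (a b : poset_of P) : (a <= b)%O = bg_le a b by [].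
rewrite /Order.comparable !leE /bg_le [v == u]eq_sym (edge_sym (v : P)).
have [//|_] /= := eqVneq u v.
case E: (edge (u : P) v); last by rewrite !andbF.
by rewrite !partAB (edge_partA E); case: (v \in _).
Qed.

Lemma chain_edge (u v : poset_of P) : edge (u : P) v -> chain [set u; v].
Proof.
move=> uv; apply/forall_inP => a /set2P aE; apply/forall_inP => b /set2P bE.
have vu : edge (v : P) u by rewrite (edge_sym (v : P)).
by rewrite comparable_edge; case: aE bE => -> [] ->; rewrite ?eqxx ?uv ?vu ?orbT.
Qed.

(** Three distinct pairwise comparable vertices would form a triangle, and a chain with fewer than
    two elements extends to an edge as no vertex is isolated. *)
Lemma chain_sub_edge (C : {set poset_of P}) : chain C ->
  exists u v : poset_of P, edge (u : P) v /\ C \subset [set u; v].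
Proof.
move=> cC; have cmp (a b : poset_of P) : a \in C -> b \in C -> (a == b) || edge (a : P) b.
  move=> aC bC; rewrite -comparable_edge.
  by move/forall_inP: cC => /(_ a aC)/forall_inP/(_ b bC).
have [->|[u uC]] := set_0Vmem C.
  have /card_gt0P[u _] := P_nonempty; have [v uv] := P_no_isolated u.
  by exists u, v; rewrite sub0set.
have [C1|[v]] := set_0Vmem (C :\ u).
  have [v uv] := P_no_isolated u; exists u, v; split=> //.
  by rewrite -(setD1K uC) C1 setU0 sub1set !inE eqxx.
rewrite !inE => /andP[vu vC].
have /orP[/eqP vu'|uv] := cmp u v uC vC; first by rewrite vu' eqxx in vu.
exists u, v; split=> //; apply/subsetP => w wC; rewrite !inE.
have /orP[->//|wu] := cmp w u wC uC; have /orP[->|wv] := cmp w v wC vC.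
  by rewrite orbT.
by have := edge_triangle_free uv wu; rewrite wv.
Qed.

Lemma maximal_chainP (C : {set poset_of P}) :
  reflect (exists u v : poset_of P, edge (u : P) v /\ C = [set u; v])
          (maximal_chain C).
Proof.
apply: (iffP maxsetP) => [[cC maxC]|[u [v [uv ->]]]].
  have [u [v [uv Cuv]]] := chain_sub_edge cC; exists u, v; split=> //.
  by rewrite (maxC _ (chain_edge uv) Cuv).
split=> [|D cD uvD]; first exact: chain_edge.
have [a [b [ab Dab]]] := chain_sub_edge cD.
(* All edges have two elements, so an inclusion between them is an equality. *)
apply/eqP; rewrite eq_sym eqEcard uvD (leq_trans (subset_leq_card Dab)) //.
by rewrite !cards2 (edge_neq uv) (edge_neq ab).
Qed.

Definition var (u : P) : 'I_#|{: poset_of P}| := enum_rank (u : poset_of P).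

Lemma var_inj : injective var.
Proof. exact: enum_rank_inj. Qed.

Definition edge_gens (t : 'X_{1..#|{: poset_of P}|}) : Prop :=
  exists u v : P, edge u v /\ t = (U_(var u) + U_(var v))%MM.

Lemma chain_monomialE (K : fieldType) (C : {set poset_of P}) :
  chain_monomial K C = 'X_[\sum_(p in C) U_(enum_rank p)].
Proof.
by rewrite /chain_monomial (big_morph _ (@mpolyXD _ K) (@mpolyX0 _ K)).
Qed.

Lemma flag_ideal_edges (K : fieldType) (f : {mpoly K[#|{: poset_of P}|]}) :
  flag_ideal f <-> mideal edge_gens f.
Proof.
have -> : mideal edge_gens f <-> mideal (fun t => exists2 C : {set poset_of P},
    maximal_chain C & t = (\sum_(p in C) U_(enum_rank p))%MM) f.
  apply: eq_mideal => t; split=> [[u [v [uv ->]]]|[_ /maximal_chainP[u [v [uv ->]]] ->]].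
    exists [set (u : poset_of P); (v : poset_of P)]; first by apply/maximal_chainP; exists u, v.
    by rewrite big_setU1 ?big_set1 // inE (edge_neq uv).
  exists u, v; split=> //.
  by rewrite big_setU1 ?big_set1 // inE (edge_neq uv).
rewrite -mideal_gens /flag_ideal.
by split=> -[c ->]; exists c; apply: eq_bigr => C _; rewrite chain_monomialE.
Qed.

(** * Induced pairs of disjoint edges *)

Lemma edge_eq_set2 (u v a b : P) :
  edge u v -> [set u; v] = [set a; b] -> edge a b.
Proof.
move=> uv E; have := set21 u v; have := set22 u v; rewrite E => /set2P vE /set2P uE.
by case: uE vE uv => -> [] ->; rewrite ?edge_irr // edge_sym.
Qed.

Lemma induced_two_disjoint_edgesP : has_induced_two_disjoint_edges P <->
  exists p1 p2 q1 q2 : P, [/\ p1 \in partA P, p2 \in partA P,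
    edge p1 q1 /\ edge p2 q2 & ~~ edge p1 q2 /\ ~~ edge p2 q1].
Proof.
split=> -[p1 [p2 [q1 [q2]]]].
  case=> -[p1A p2A] [q1B q2B] /= /and4P[].
  rewrite !inE !negb_or => /and3P[p12 p1q1 p1q2] /andP[p2q1 p2q2] q12 _.
  set W := [set _; _; _; _] => E.
  have WE u v : u \in W -> v \in W -> edge u v ->
      [set u; v] = [set p1; q1] \/ [set u; v] = [set p2; q2].
    move=> uW vW uv; apply/set2P; rewrite -E; apply/imset2P.
    by exists u v; rewrite // inE vW.
  have edgeE a b : [set a; b] \in induced_edges W -> edge a b.
    case/imset2P=> u v _; rewrite inE => /andP[_ uv] /esym.
    exact: edge_eq_set2.
  exists p1, p2, q1, q2; split=> //.
    by split; apply: edgeE; rewrite E ?set21 ?set22.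
  split; apply/negP => pq.
    have [||//|E1|E1] := WE p1 q2; rewrite ?inE ?eqxx ?orbT //.
      by have := set22 p1 q2; rewrite E1 !inE eq_sym (negPf p1q2) eq_sym (negPf q12).
    by have := set21 p1 q2; rewrite E1 !inE (negPf p12) (negPf p1q2).
  have [||//|E1|E1] := WE p2 q1; rewrite ?inE ?eqxx ?orbT //.
    by have := set21 p2 q1; rewrite E1 !inE eq_sym (negPf p12) (negPf p2q1).
  by have := set22 p2 q1; rewrite E1 !inE eq_sym (negPf p2q1) (negPf q12).
case=> p1A p2A [e1 e2] [n1 n2]; exists p1, p2, q1, q2.
have q1A : q1 \notin partA P by rewrite -(edge_partA e1).
have q2A : q2 \notin partA P by rewrite -(edge_partA e2).
have pq p q : p \in partA P -> q \notin partA P -> p != q.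
  by move=> pA; apply: contraNneq => <-.
split; rewrite ?partAB //=.
  rewrite !inE !negb_or (pq p1 q1) ?(pq p1 q2) ?(pq p2 q1) ?(pq p2 q2) // !andbT.
  by apply/andP; split; [apply: contraNneq n2 => <-|apply: contraNneq n1 => <-].
apply/setP => C; apply/imset2P/set2P => [[u v]|[]->]; last 2 first.
- by exists p1 q1; rewrite ?inE ?eqxx ?orbT ?e1.
- by exists p2 q2; rewrite ?inE ?eqxx ?orbT ?e2.
rewrite !inE -!orbA => /or4P uW /andP[/or4P vW] + ->.
have inA := (p1A, p2A, negPf q1A, negPf q2A).
(* Pairs inside a part are excluded by [edge_partA], crossed pairs by [n1] and [n2]; the given edges
   remain, in either order. *)
case: uW vW => /eqP-> [] /eqP-> uv; try by have := edge_partA uv; rewrite !inA.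
all: try by case/negP: n1; rewrite // edge_sym.
all: try by case/negP: n2; rewrite // edge_sym.
all: try by [left|right].
all: by rewrite setUC; auto.
Qed.

(** * Nested neighbourhoods and the Ferrers labelling *)

Definition deg (u : P) := #|[set v | edge u v]|.

(** If [u'] missed the neighbour [v] of [u], the degrees would force a neighbour [v'] of [u'] missed
    by [u], and [u v], [u' v'] would be an induced pair. *)
Lemma deg_edge (u u' v : P) : ~ has_induced_two_disjoint_edges P ->
  (u \in partA P) = (u' \in partA P) -> (deg u <= deg u')%N ->
  edge u v -> edge u' v.
Proof.
move=> nind uu' le_deg uv; apply: contraT => u'v.
have [v' u'v' uv'] : exists2 v', edge u' v' & ~~ edge u v'.
  apply/exists_inP; apply: contraLR le_deg; rewrite negb_exists_in => /forall_inP sub.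
  rewrite -ltnNge; apply: proper_card; apply/properP; split.
    by apply/subsetP => w; rewrite !inE => /sub; rewrite negbK.
  by exists v; rewrite inE.
case: nind; apply/induced_two_disjoint_edgesP.
have [uA|uA] := boolP (u \in partA P).
  by exists u, u', v, v'; split; rewrite // -uu'.
exists v, v', u, u'; split.
- by rewrite -[_ \in _]negbK -(edge_partA uv).
- by rewrite -[_ \in _]negbK -(edge_partA u'v') -uu'.
- by rewrite ![edge _ u]edge_sym ![edge _ u']edge_sym.
- by rewrite ![edge _ u]edge_sym ![edge _ u']edge_sym.
Qed.

Lemma part_enumeration (B : {set P}) : (0 < #|B|)%N ->
  exists (n : nat) (x : 'I_n.+1 -> P),
    [/\ injective x, forall v, v \in B <-> exists i, v = x i &
        forall i j : 'I_n.+1, (i <= j)%N -> (deg (x j) <= deg (x i))%N].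
Proof.
(* The order is reversed: the largest degrees come first. *)
move=> /card_gt0P[u0 u0B]; pose r u v := (deg v <= deg u)%N.
pose s := sort r (enum B).
have s_uniq : uniq s by rewrite sort_uniq enum_uniq.
have sB v : (v \in s) = (v \in B) by rewrite mem_sort mem_enum.
have size_s : size s = (size s).-1.+1.
  by rewrite prednK // lt0n size_eq0; apply: contraTneq u0B => s0; rewrite -sB s0.
have lt_s (i : 'I_(size s).-1.+1) : (i < size s)%N.
  exact: leq_trans (ltn_ord i) (eq_leq (esym size_s)).
have r_total : total r by move=> u v; apply: leq_total.
have r_trans : transitive r by move=> v u w uv vw; apply: leq_trans vw uv.
have r_refl : reflexive r by move=> u; apply: leqnn.
exists (size s).-1, (fun i => nth u0 s i); split=> [i j|v|i j ij].
- by move/eqP; rewrite nth_uniq ?lt_s // => /eqP/val_inj.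
- split=> [|[i ->]]; last by rewrite -sB mem_nth.
  rewrite -sB => vs; have lt_v : (index v s < (size s).-1.+1)%N.
    by rewrite -size_s index_mem.
  by exists (Ordinal lt_v); rewrite nth_index.
- by apply: (sorted_leq_nth r_trans r_refl); rewrite ?sort_sorted // inE.
Qed.

Lemma Ferrers_of_no_induced : ~ has_induced_two_disjoint_edges P -> is_Ferrers P.
Proof.
move=> nind.
have [a [b [aA ab]]] : exists a b : P, a \in partA P /\ edge a b.
  have /card_gt0P[u _] := P_nonempty; have [v uv] := P_no_isolated u.
  have [uA|uA] := boolP (u \in partA P); first by exists u, v.
  exists v, u; rewrite (edge_sym v) uv -[_ \in _]negbK.
  by rewrite -(edge_partA uv).
have [|n [x [x_inj xA x_deg]]] := @part_enumeration (partA P).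
  by apply/card_gt0P; exists a.
have [|m [y [y_inj yB y_deg]]] := @part_enumeration (partB P).
  by apply/card_gt0P; exists b; rewrite partAB -(edge_partA ab).
have xiA i : x i \in partA P by apply/xA; exists i.
have yjA j : y j \in partA P = false.
  by apply: negbTE; rewrite -partAB; apply/yB; exists j.
have xE v : v \in partA P -> exists i, v = x i by move/xA.
have yE v : v \notin partA P -> exists j, v = y j by rewrite -partAB => /yB.
(* [deg_edge] is applied once in each part: first [x p] is replaced by [x i], then [y q] by
   [y j]. *)
have up (p i : 'I_n.+1) (q j : 'I_m.+1) :
    edge (x p) (y q) -> (i <= p)%N -> (j <= q)%N -> edge (x i) (y j).
  move=> pq ip jq.
  have iq : edge (x i) (y q).
    by apply: deg_edge pq; rewrite ?xiA // x_deg.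
  rewrite edge_sym; apply: (@deg_edge (y q)); rewrite ?yjA ?y_deg //.
  by rewrite edge_sym.
exists n, m, x, y; split=> //.
- split=> // [i j|v].
    by apply: contraTneq (xiA i) => ->; rewrite yjA.
  by have [/xE|/yE] := boolP (v \in partA P); [left|right].
- by split=> i j; apply/negP => /edge_partA; rewrite ?xiA ?yjA.
- split.
    (* The last vertex of a part has some neighbour, which [up] moves to index [0]. *)
    have [v yv] := P_no_isolated (y ord_max).
    have /xE[p vE] : v \in partA P by rewrite -[_ \in _]negbK -(edge_partA yv) yjA.
    by apply: (up p _ ord_max); rewrite // edge_sym -vE.
  have [v xv] := P_no_isolated (x ord_max).
  have /yE[q vE] : v \notin partA P by rewrite -(edge_partA xv).
  by apply: (up ord_max _ q); rewrite // -vE.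
Qed.

(** * The obstruction from two disjoint edges *)

Lemma edge_gens_coeff (K : fieldType) (f : {mpoly K[#|{: poset_of P}|]}) k :
  flag_ideal f -> f@_k != 0 ->
  exists u v : P, edge u v /\ (U_(var u) + U_(var v) <= k)%MM.
Proof.
move=> /flag_ideal_edges hf; rewrite -mcoeff_msupp => /hf[_ [u [v [uv ->]]] uvk].
by exists u, v.
Qed.

(** Since [x] is adjacent to neither [p] nor [q], the only edge among the three vertices is
    [p q]. *)
Lemma le_edge_gens (x p q u v : P) :
  edge p q -> ~~ edge x p -> ~~ edge x q -> edge u v ->
  (U_(var u) + U_(var v) <= U_(var x) + (U_(var p) + U_(var q)))%MM ->
  (U_(var u) + U_(var v) = U_(var p) + U_(var q))%MM.
Proof.
move=> pq xp xq uv le_uv.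
have mem w : (U_(var w) <= U_(var x) + (U_(var p) + U_(var q)))%MM ->
    [\/ w = x, w = p | w = q].
  rewrite lep1mP !mnmDE !mnm1E !(inj_eq var_inj).
  have [->|_] := eqVneq x w; first by constructor 1.
  have [->|_] := eqVneq p w; first by constructor 2.
  by have [->|_] := eqVneq q w; first by constructor 3.
have [uE vE] := (mem u (lepm_trans (lem_addr _ _) le_uv),
                 mem v (lepm_trans (lem_addl _ _) le_uv)).
case: uE vE uv => -> [] -> //; rewrite ?edge_irr ?(negPf xp) ?(negPf xq) //.
- by rewrite edge_sym (negPf xp).
- by rewrite edge_sym (negPf xq).
- by rewrite addmC.
Qed.

Section Obstruction.
Variables (K : fieldType) (p q : P) (N : nat).
Variable g : 'cV[{mpoly K[#|{: poset_of P}|]}]_N.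
Hypotheses (pq : edge p q) (g_flag : forall r, flag_ideal (g r ord0)).
Let m : 'X_{1..#|{: poset_of P}|} := (U_(var p) + U_(var q))%MM.

(* [x_p x_q] is the only generator dividing [x_x x_p x_q]. *)
Lemma linear_syzygy_coeff (w : 'rV_N) (x : P) :
  ~~ edge x p -> ~~ edge x q -> (forall r, w ord0 r \is 1.-homog) ->
  w *m g = 0 -> \sum_r (w ord0 r)@_U_(var x) * (g r ord0)@_m = 0.
Proof.
move=> xp xq w1 /matrixP/(_ ord0 ord0)/(congr1 (mcoeff (U_(var x) + m))).
rewrite !mxE mcoeff0 raddf_sum /= => wg.
rewrite -[RHS]wg; apply: eq_bigr => r _; rewrite mcoeffM_unique // => k l kl kx.
apply: contraNeq kx; rewrite mulf_eq0 negb_or => /andP[wk gl].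
have dk : mdeg k = 1%N.
  by apply/eqP; apply: contraNT wk => dk; rewrite (dhomog_nemf_coeff (w1 r)).
have [u [v [uv uvl]]] := edge_gens_coeff (g_flag r) gl.
have uvE : (U_(var u) + U_(var v) = m)%MM.
  by apply: (le_edge_gens pq xp xq uv); rewrite -kl (lepm_trans uvl) ?lem_addl.
move: kl; rewrite uvE in uvl; rewrite -(submK uvl) addmA => /addIm kl.
have := congr1 mdeg kl; rewrite mdegD dk mdeg1 => -[] /eqP.
by rewrite mdeg_eq0 => /eqP l0; rewrite -kl l0 addm0.
Qed.

(** Elements of the flag ideal have no terms of degree below two, so only the constant terms of [v]
    reach the quadratic monomial [m]. *)
Lemma generator_coeff (v : 'rV_N) :
  (v *m g) ord0 ord0 = 'X_[m] -> \sum_r (v ord0 r)@_0 * (g r ord0)@_m = 1.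
Proof.
have Xm : ('X_[m] : {mpoly K[_]})@_(0 + m) = 1 by rewrite add0m mcoeffX eqxx.
move/(congr1 (mcoeff (0 + m))); rewrite mxE raddf_sum /= Xm => <-.
apply: eq_bigr => r _; rewrite mcoeffM_unique // => k l /(congr1 mdeg) kl k0.
have [->|gl] := eqVneq (g r ord0)@_l 0; first by rewrite mulr0.
have [a [b [_ abl]]] := edge_gens_coeff (g_flag r) gl.
move: kl; rewrite -(submK abl) !mdegD mdeg0 !mdeg1 addnA => /addIn/eqP.
by rewrite addn_eq0 mdeg_eq0 (negPf k0).
Qed.
End Obstruction.

Lemma no_induced_of_linear_resolution (K : fieldType) :
  has_linear_resolution (@flag_ideal K _ (poset_of P)) ->
  ~ has_induced_two_disjoint_edges P.
Proof.
move=> [F [_ [d shift]]] /induced_two_disjoint_edgesP.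
move=> [p1 [p2 [q1 [q2 [p1A p2A [e1 e2] [n1 n2]]]]]].
pose g := fr_aug F; pose D := fr_diff F 0.
have gI r : flag_ideal (g r ord0).
  apply/(fr_aug_image F); exists (delta_mx ord0 r).
  by rewrite -rowE mxE.
have D1 i r : D i r \is 1.-homog.
  have : graded_entry _ _ (D i r) := fr_diff_graded i r.
  by rewrite /graded_entry !shift addn0 addn1 leqnSn subSnn.
have Dg : D *m g = 0.
  apply/row_matrixP => i; rewrite row_mul row0; apply/fr_exact0.
  by exists (delta_mx ord0 i); rewrite rowE.
have gen (u v : P) : edge u v -> exists w : 'rV_(fr_rank F 0),
    (w *m g) ord0 ord0 = 'X_[U_(var u) + U_(var v)].
  move=> uv; have /(fr_aug_image F)[w wE] :
      flag_ideal ('X_[U_(var u) + U_(var v)] : {mpoly K[#|{: poset_of P}|]}).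
    apply/flag_ideal_edges => m; rewrite msuppX inE => /eqP ->.
    by exists (U_(var u) + U_(var v))%MM; [exists u, v|exact: lepm_refl].
  by exists w; rewrite wE.
set m1 := (U_(var p1) + U_(var q1))%MM; set m2 := (U_(var p2) + U_(var q2))%MM.
have [w1 w1E] := gen _ _ e1; have [w2 w2E] := gen _ _ e2.
(* The Koszul relation, written on preimages of the two generators. *)
pose v := 'X_[m2] *: w1 - 'X_[m1] *: w2.
have [w vE] : exists w, v = w *m D.
  have scaleE c (u : 'rV_(fr_rank F 0)) :
      ((c *: u) *m g) ord0 ord0 = c * (u *m g) ord0 ord0.
    by rewrite -scalemxAl mxE.
  apply/fr_exact0/matrixP => a b; rewrite !ord1 mulmxBl [LHS]mxE [X in _ + X]mxE.
  by rewrite !scaleE w1E w2E mulrC subrr mxE.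
have m12 : ~~ (m1 <= m2)%MM.
  have p12 : p2 != p1 by apply: contraNneq n2 => ->.
  have q2p1 : q2 != p1.
    by apply: contraTneq p1A => <-; rewrite -(edge_partA e2).
  apply/negP => /(lepm_trans (lem_addr _ _)).
  by rewrite lep1mP mnmDE !mnm1E !(inj_eq var_inj) (negPf p12) (negPf q2p1).
(* The second summand of [v] does not contribute, as [m1] does not divide [m2]. *)
have lhs : \sum_r (v ord0 r)@_m2 * (g r ord0)@_m1 = 1.
  rewrite -(generator_coeff gI w1E); apply: eq_bigr => r _; congr (_ * _).
  rewrite !mxE mcoeffB [_ * w1 _ _]mulrC [_ * w2 _ _]mulrC.
  by rewrite (mcoeffMX_eq0 _ m12) subr0 -[RHS](mcoeffMX _ m2) addm0.
(* Writing the entries of [D] as combinations of variables, the sum splits over the rows [t] and the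
   variables [i]. *)
have rhs : \sum_r (v ord0 r)@_m2 * (g r ord0)@_m1 = 0.
  under eq_bigr => r _.
    rewrite vE mxE raddf_sum mulr_suml /=.
    under eq_bigr => t _.
      rewrite {1}(linear_formE (D1 t r)) mulr_sumr raddf_sum mulr_suml /=.
      under eq_bigr => i _ do rewrite -scalerAr mcoeffZ mulrAC mulrC.
      over.
    over.
  rewrite exchange_big big1 //= => t _; rewrite exchange_big big1 //= => i _.
  rewrite -mulr_sumr.
  have [im2|im2] := boolP (U_(i) <= m2)%MM; last by rewrite mcoeffMX_eq0 ?mul0r.
  (* A variable dividing [m2] belongs to [p2] or [q2]; neither is adjacent to [p1] or [q1], so
     [linear_syzygy_coeff] applies. *)
  have [x [iE xp xq]] : exists x, [/\ i = var x, ~~ edge x p1 & ~~ edge x q1].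
    have noA u u' : (u \in partA P) = (u' \in partA P) -> ~~ edge u u'.
      by move=> uu'; apply/negP => /edge_partA; rewrite uu'; case: (_ \in _).
    move: im2; rewrite lep1mP mnmDE !mnm1E.
    have [<- _|_] := eqVneq (var p2) i.
      by exists p2; split=> //; apply: noA; rewrite p1A p2A.
    have [<- _|//] := eqVneq (var q2) i.
    exists q2; split; rewrite // 1?edge_sym //; apply: noA.
    by apply/negb_inj; rewrite -(edge_partA e2) -(edge_partA e1) p1A p2A.
  have rowD1 r : row t D ord0 r \is 1.-homog by rewrite mxE.
  have rowDg : row t D *m g = 0 by rewrite -row_mul Dg row0.
  have syz := linear_syzygy_coeff e1 gI xp xq rowD1 rowDg.
  rewrite -[RHS](mulr0 (w ord0 t * 'X_i)@_m2) -[X in _ = _ * X]syz; congr (_ * _).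
  by apply: eq_bigr => r _; rewrite mxE iE.
by have /eqP := oner_neq0 K; rewrite -lhs rhs.
Qed.

(** * Ferrers graphs have linear resolutions, and the equivalence *)

Lemma linear_resolution_of_Ferrers (K : fieldType) :
  is_Ferrers P -> has_linear_resolution (@flag_ideal K _ (poset_of P)).
Proof.
case=> n [m [x [y [[x_inj y_inj xy cover] [xx yy] up _]]]].
apply: (@linres_has_linear_resolution K _ 2).
have := @linres_ferrers K _ _ _ (var \o x) (var \o y) (fun i j => edge (x i) (y j))
  (inj_comp var_inj x_inj) (inj_comp var_inj y_inj) _ up.
move=> H; apply: linres_ext (H _) => [f|i j]; last by rewrite (inj_eq var_inj).
rewrite flag_ideal_edges; apply: eq_mideal => t.
split=> [[i [j [ij ->]]]|[u [v [uv ->]]]]; first by exists (x i), (y j).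
(* The labelled classes are independent sets, so an edge joins some [x i] and [y j], in one order or
   the other. *)
case: (cover u) (cover v) uv => -[i ->] [] [j ->].
- by move=> ij; have := xx i j; rewrite ij.
- by move=> ij; exists i, j.
- by move=> ij; exists j, i; rewrite edge_sym addmC.
- by move=> ij; have := yy i j; rewrite ij.
Qed.

End BipartiteFlagIdeal.

Theorem theorem6p2 (K : fieldType) (P : bigraph)
    (P_nonempty : (0 < #|P|)%N) (P_no_isolated : no_isolated P) :
  [<-> has_linear_resolution (@flag_ideal K _ (poset_of P));
       ~ has_induced_two_disjoint_edges P;
       is_Ferrers P].
Proof.
tfae.
- exact: no_induced_of_linear_resolution.
- exact: Ferrers_of_no_induced.
- exact: linear_resolution_of_Ferrers.
Qed.
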